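(* Let $X$ be a real random variable with the logistic distribution, i.e. with distribution function $$F(x)=\frac{1}{1+e^{-x}},\qquad x\in\mathbb{R}.$$ Let $\delta\in\mathbb{R}$, $\delta\neq 0$, and put $$\theta:=F(\delta)=\frac{e^{\delta}}{1+e^{\delta}}.$$ Then $$|X+\delta|\;=_{\mathcal D}\;\sum_{j=1}^{N}\frac1j\,E_j\qquad\text{and}\qquad (X+\delta)^2\;=_{\mathcal D}\;\max\{E_1^2,E_2^2,\ldots,E_N^2\},$$ where $N,E_1,E_2,\ldots$ are independent random variables, every $E_j$ ($j\in\mathbb{N}$) is exponentially distributed with mean $1$, and $N$ has the distribution $$P(N=n)=\theta\,(1-\theta)^n+(1-\theta)\,\theta^n\qquad\text{for all } n\in\mathbb{N}.$$
   Context: $\mathbb{N}=\{1,2,3,\ldots\}$ (zero is not included). The symbol $=_{\mathcal D}$ denotes equality in distribution. *)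

(* Defs.v *)
From HB Require Import structures.
From mathcomp Require Import all_boot all_order all_algebra.
From mathcomp Require Import finmap.
From mathcomp Require Import all_classical all_reals all_analysis.

Set Implicit Arguments.
Unset Strict Implicit.
Unset Printing Implicit Defensive.

Import Order.TTheory GRing.Theory Num.Theory.

Local Open Scope classical_set_scope.
Local Open Scope ring_scope.

Definition logistic_cdf (R : realType) (x : R) : R := (1 + expR (- x))^-1.

Lemma logistic_cdfE (R : realType) (x : R) :
  logistic_cdf x = expR x / (1 + expR x).
Proof.
have ex0 : expR x != 0 by rewrite gt_eqF// expR_gt0.
have -> : 1 + expR x = expR x * (1 + expR (- x)).
  by rewrite mulrDr mulr1 expRN divff// addrC.
by rewrite invfM mulrA divff// mul1r.
Qed.

(* Only measurable B are compared: a MathComp-Analysis measure is a function on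
   all sets, whose values outside the sigma-algebra are unconstrained.
   The measurability of X and Y is part of the claim. *)
Definition eq_in_distribution (R : realType)
    (d : measure_display) (T : measurableType d) (P : probability T R)
    (d' : measure_display) (T' : measurableType d') (P' : probability T' R)
    (X : T -> R) (Y : T' -> R) : Prop :=
  [/\ measurable_fun [set: T] X,
      measurable_fun [set: T'] Y &
      forall B : set R, measurable B -> P (X @^-1` B) = P' (Y @^-1` B)].

(* Families of set systems rather than of random variables, so that the members
   may be generated by random variables with different codomains. *)
Definition mutually_independent (R : realType)
    (d : measure_display) (T : measurableType d) (P : probability T R)
    (I : choiceType) (F : I -> set (set T)) : Prop :=
  forall (J : {fset I}) (A : I -> set T),
    (forall i, i \in J -> F i (A i)) ->
    P (\bigcap_(i in [set` J]) A i) = (\prod_(i <- J) P (A i))%E.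

(* The sigma-algebras of the sequence N, E 1, E 2, ... listed from index 0;
   E 0 plays no role. *)
Definition sigma_count_family (R : realType)
    (d : measure_display) (T : measurableType d)
    (N : T -> nat) (E : nat -> T -> R) (k : nat) : set (set T) :=
  if k is 0 then g_sigma_algebra_preimage N
  else g_sigma_algebra_preimage (E k).

(* Main.v *)
Require Import Defs.
From HB Require Import structures.
From mathcomp Require Import all_boot all_order all_algebra finmap.
From mathcomp Require Import all_classical all_reals all_analysis.
From mathcomp Require Import ring lra measurable_realfun.

Set Implicit Arguments.
Unset Strict Implicit.
Unset Printing Implicit Defensive.

Import Order.TTheory GRing.Theory Num.Theory.
Import numFieldNormedType.Exports.

Local Open Scope classical_set_scope.
Local Open Scope ring_scope.

(** Both sides of each identity have the same distribution function, and a law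
    on the line is determined by its distribution function
    ([eq_in_distribution_cdf]).

    On the left, put s = exp (- t).  For t >= 0, P(|X + delta| <= t) is the
    logistic mass F(t - delta) - F(- t - delta) of an interval; it is a rational
    function of s and exp delta.  On the right, given N = n both the sum of the
    E_j / j and the maximum of the E_j over j <= n are at most t with
    probability u ^ n, where u = 1 - s.  Averaging over N therefore gives the
    generating function of N at u, two geometric series
    ([geometric_mixture_series]), and clearing denominators shows that it is the
    same rational function ([logistic_interval], [abs_logistic_cdf]).
    At u = 1 the two series sum to 1, so N vanishes with probability 0
    ([random_index_eq0]) and only the values n >= 1 matter.

    That the sum and the maximum have the same law is Renyi's representation of
    exponential order statistics: the successive spacings between the order
    statistics of n independent exponentials are independent and distributed
    as E_n / n, ..., E_1 / 1.  Here it is proved by induction on n, adding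
    E_(n+1) / (n+1) to the sum.  Independence turns the joint law of the old
    sum and the new term into a product measure ([joint_law_of_rectangles]), and
    the resulting convolution integral has the explicit primitive
    - (exp (- x / (n+1)) - exp (- t)) ^ (n+1)  ([integral_spacing_step],
    [spacing_step_cdf]).

    The hypothesis of independence speaks only of finite families of events, one
    for each variable.  To carry N along, the inductions quantify over all
    events depending on N and on finitely many later E_j ([tail_event]): such a
    class absorbs the event on E_(m+1) when m + 1 is lowered to m
    ([tail_eventI]).

    The squares reduce to the same computation, since (X + delta) ^ 2 <= t means
    |X + delta| <= sqrt t, and E_j ^ 2 <= t has probability 1 - exp (- sqrt t).
*)

(** * Laws on the line and product laws *)

(** The open upper rays generate the Borel sets and are stable under
    intersection, so two laws that agree on them agree everywhere. *)
Lemma eq_in_distribution_cdf (R : realType)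
    (d : measure_display) (T : measurableType d) (P : probability T R)
    (d' : measure_display) (T' : measurableType d') (P' : probability T' R)
    (X : T -> R) (Y : T' -> R) :
  measurable_fun [set: T] X -> measurable_fun [set: T'] Y ->
  (forall t, P [set w | X w <= t] = P' [set w | Y w <= t]) ->
  eq_in_distribution P P' X Y.
Proof.
move=> mX mY XY; split=> // B mB.
pose X' : {mfun T >-> R} := mfun_Sub (mem_set mX).
pose Y' : {mfun T' >-> R} := mfun_Sub (mem_set mY).
have gt_tail d0 (T0 : measurableType d0) (P0 : probability T0 R)
    (Z : {mfun T0 >-> R}) (t : R) :
    distribution P0 Z `]t, +oo[ = (1 - P0 [set w | Z w <= t]%R)%E.
  rewrite -probability_setC; last first.
    rewrite (_ : mkset _ = Z @^-1` `]-oo, t]); first exact: measurable_funPTI.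
    by apply/seteqP; split => w; rewrite /= in_itv.
  congr (P0 _); apply/seteqP; split => w /=; rewrite in_itv/= andbT ltNge;
    by move/negP.
suff : distribution P X' B = distribution P' Y' B by [].
pose g n : set R := `](- n%:R), +oo[%classic.
refine (@measure_unique _ R R (@RGenOInfty.G R) g (@RGenOInfty.measurableE R) _ _ _
  (distribution P X') (distribution P' Y') _ _ B mB) => //.
- move=> _ _ [x ->] [y ->]; exists (Num.max x y); apply/seteqP; split => z /=;
  rewrite !in_itv/= !andbT gt_max; first by case=> -> ->.
  by move/andP.
- by move=> i; exists (- i%:R).
- apply/seteqP; split => // x _; exists (Num.truncn (- x)).+1 => //.
  by rewrite /g /= in_itv/= andbT ltrNl Num.Theory.truncnS_gt.
- move=> _ [x ->]; apply: (etrans (gt_tail _ _ P X' x)).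
  apply: esym; apply: (etrans (gt_tail _ _ P' Y' x)); congr (1 - _)%E.
  exact: esym (XY x).
- move=> k; apply: (@le_lt_trans _ _ 1%E); last exact: ltry.
  by apply: (probability_le1 (distribution P X')); exact: measurable_itv.
Qed.

(** Rectangles generate the product sigma-algebra and are stable under
    intersection, so the restriction to [C] of the joint law is a multiple of
    the product measure.  The event [C] is there to let the independence from
    further variables go through the induction on the number of summands. *)
Lemma joint_law_of_rectangles (R : realType) d (T : measurableType d)
    d1 (T1 : measurableType d1) d2 (T2 : measurableType d2)
    (P : probability T R) (X : {RV P >-> T1}) (Y : {RV P >-> T2}) (C : set T) :
  measurable C ->
  (forall A B, measurable A -> measurable B ->
    P (X @^-1` A `&` Y @^-1` B `&` C) =
      P (X @^-1` A) * P (Y @^-1` B) * P C)%E ->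
  forall D : set (T1 * T2), measurable D ->
  P ([set w | D (X w, Y w)] `&` C) =
    ((distribution P X \x distribution P Y) D * P C)%E.
Proof.
move=> mC indep D mD.
have mXY : measurable_fun [set: T] (fun w => (X w, Y w)).
  exact: measurable_fun_pair.
pose joint : measure (T1 * T2)%type R :=
  measure_function_pushforward__canonical__measure_function_Measure
    (mrestr P mC) mXY.
have PC0 : (0 <= fine (P C))%R by exact: fine_ge0.
pose prodC : measure (T1 * T2)%type R :=
  mscale (NngNum PC0) (distribution P X \x distribution P Y)%E.
have prodCE B : prodC B = ((distribution P X \x distribution P Y) B * P C)%E.
  by rewrite /prodC/= /mscale/= fineK ?fin_num_measure// muleC.
rewrite -prodCE -[LHS]/(joint D).
pose rect : set (set (T1 * T2)) :=
  [set A `*` B | A in measurable & B in measurable].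
apply: (@measure_unique _ _ _ rect (fun=> setT)) => //.
- exact: measurable_prod_measurableType.
- move=> _ _ [A mA [B mB <-]] [A' mA' [B' mB' <-]]; rewrite -setXI.
  by exists (A `&` A'); [exact: measurableI|exists (B `&` B') => //;
    exact: measurableI].
- by move=> _; exists setT => //; exists setT => //; rewrite setXTT.
- by rewrite bigcup_const//; exists 0%N.
- move=> _ [A mA [B mB <-]]; rewrite prodCE product_measure1E//.
  exact: indep.
- move=> _; rewrite /joint/= /pushforward /mrestr preimage_setT setTI.
  by rewrite -ge0_fin_numE// fin_num_measure.
Qed.

(** By uniqueness of densities, [f] coincides almost everywhere with the
    Radon-Nikodym derivative of [nu], for which the formula is known. *)
Lemma integral_density d (T : measurableType d) (R : realType)
    (nu : {finite_measure set T -> \bar R})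
    (mu : {sigma_finite_measure set T -> \bar R}) (f : T -> \bar R) :
  measurable_fun [set: T] f ->
  (forall A, measurable A -> nu A = \int[mu]_(x in A) f x)%E ->
  forall g : T -> \bar R, nu.-integrable [set: T] g ->
  (\int[nu]_x g x = \int[mu]_x (g x * f x))%E.
Proof.
move=> mf nuE g ig.
have numu : nu `<< mu.
  apply/null_content_dominatesP => A mA A0.
  by rewrite nuE// null_set_integral//; exact: measurable_funTS.
rewrite -(Radon_Nikodym_change_of_variables numu)//=.
have mg := measurable_int _ ig.
apply: ae_eq_integral => //; [exact: emeasurable_funM|exact: emeasurable_funM|].
apply: ae_eqe_mul2l; apply: integral_ae_eq => //.
  exact: Radon_Nikodym_integrable.
by move=> A _ mA; rewrite -nuE// -Radon_Nikodym_integral.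
Qed.

(** * Convolution with an exponential variable *)

(** The distribution function of the maximum of [n] independent unit
    exponentials.  For [n = 0] it is that of the constant 0, the empty sum from
    which the induction starts. *)
Definition max_exp_cdf (R : realType) (n : nat) (t : R) : R :=
  if 0 <= t then (1 - expR (- t)) ^+ n else 0.

(** The convolution integral of the induction step; its integrand is the
    derivative of [- (expR (- x / n.+1) - expR (- t)) ^+ n.+1]. *)
Lemma integral_spacing_step (R : realType) (n : nat) (t : R) : 0 <= t ->
  (\int[lebesgue_measure]_(x in `[0%R, (n.+1%:R * t)%R])
     ((expR (- (n.+1%:R^-1 * x)) - expR (- t)) ^+ n *
      expR (- (n.+1%:R^-1 * x)))%:E)%E = ((1 - expR (- t)) ^+ n.+1)%:E.
Proof.
(* the fundamental theorem of calculus needs a nondegenerate interval *)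
rewrite le_eqVlt => /orP[/eqP <-|t0].
  by rewrite mulr0 set_itv1 integral_set1 oppr0 expR0 subrr expr0n.
have n0 : n.+1%:R != 0 :> R by rewrite pnatr_eq0.
pose h (x : R^o) : R^o := expR (- (n.+1%:R^-1 * x)).
pose G (x : R^o) : R^o := - (h x - expR (- t)) ^+ n.+1.
have dh (x : R^o) : is_derive x 1 h (- n.+1%:R^-1 * h x).
  rewrite /h; apply: is_derive_eq.
  by rewrite /GRing.scale/= mulr1 mulrC.
have dG (x : R^o) : is_derive x 1 G ((h x - expR (- t)) ^+ n * h x).
  have -> : G = - (h - cst (expR (- t))) ^+ n.+1.
    by apply/funext => y; rewrite /G !fctE.
  apply: is_derive_eq; rewrite subr0 /GRing.scale/= !fctE.
  by field; rewrite nat1r.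
have ch : continuous h.
  by move=> x; apply: differentiable_continuous; apply/derivable1_diffP.
have cG : continuous G.
  by move=> x; apply: differentiable_continuous; apply/derivable1_diffP.
rewrite (@continuous_FTC2 _ _ G).
- rewrite /G /h mulr0 oppr0 expR0 mulKf// subrr expr0n/= oppr0.
  by rewrite add0e opprK.
- by rewrite mulr_gt0// ltr0n.
- apply: continuous_subspaceT => x.
  have -> : (fun x : R^o => (h x - expR (- t)) ^+ n * h x) =
      (h - cst (expR (- t))) ^+ n * h by apply/funext => y; rewrite !fctE.
  by apply: differentiable_continuous; apply/derivable1_diffP.
- split.
  + by move=> x _; exact: ex_derive.
  + by apply/cvg_at_right_filter; exact: cG.
  + by apply/cvg_at_left_filter; exact: cG.
- by move=> x _; rewrite derive1E derive_val.
Qed.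

(** One step of Renyi's representation: adding an independent [E / n.+1] to a
    variable distributed as the maximum of [n] unit exponentials gives one
    distributed as the maximum of [n.+1] of them. *)
Lemma spacing_step_cdf (R : realType) (nu mu : probability R R) (n : nat)
    (t : R) :
  (forall A, measurable A -> nu A = exponential_prob 1 A) ->
  (forall s, mu `]-oo, s]%classic = (max_exp_cdf n s)%:E) ->
  (nu \x mu)%E [set p | n.+1%:R^-1 * p.1 + p.2 <= t] =
    (max_exp_cdf n.+1 t)%:E.
Proof.
move=> nuE muE.
have mH : measurable_fun [set: R] (max_exp_cdf n : R -> R).
  apply: measurable_fun_ifT => //.
    exact: measurable_fun_ler.
  apply: measurable_funX; apply: measurable_funB => //.
  exact: measurableT_comp.
pose K (x : R) : R := max_exp_cdf n (t - n.+1%:R^-1 * x).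
have mK : measurable_fun [set: R] K.
  apply: measurableT_comp => //; exact: measurable_funB.
have K01 x : 0 <= K x <= 1.
  have : (0 <= (K x)%:E <= 1)%E by rewrite -muE measure_ge0 probability_le1.
  by rewrite !lee_fin.
transitivity (\int[nu]_x (K x)%:E)%E.
  apply: eq_integral => x _ /=; rewrite -muE; congr (mu _).
  apply/seteqP; split => y; rewrite /xsection/= in_itv/= lerBrDl.
    by move/set_mem.
  by move=> xyt; apply/mem_set.
(* [lebesgue_measure] lives on [measurableTypeR R], which has the same
   measurable sets as [R] but another display; the identity transports [nu] *)
have mid : @measurable_fun _ _ R (measurableTypeR R) [set: R] idfun.
  exact: measurable_id.
pose idR : {mfun R >-> measurableTypeR R} :=
  @mfun_Sub _ _ R (measurableTypeR R) idfun (mem_set mid).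
pose nu' : probability (measurableTypeR R) R := distribution nu idR.
transitivity (\int[nu']_x (K x)%:E)%E.
  rewrite ge0_integral_pushforward//.
  - exact/measurable_EFinP.
  - by move=> x _; rewrite lee_fin; case/andP: (K01 x).
have pdfE A : measurable A -> nu' A =
    (\int[lebesgue_measure]_(x in A) (exponential_pdf 1 x)%:E)%E.
  by move=> mA; rewrite -[LHS]/(nu A) nuE.
rewrite (integral_density _ pdfE); last 2 first.
- by apply/measurable_EFinP; exact: measurable_exponential_pdf.
- apply: (@le_integrable _ _ _ nu' _ measurableT _ (cst 1%E)).
  + exact/measurable_EFinP.
  + move=> x _ /=; have /andP[K0 K1] := K01 x.
    by rewrite normr1 lee_fin ger0_norm.
  + exact: finite_measure_integrable_cst.
transitivity (\int[lebesgue_measure]_x (((fun x =>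
     ((expR (- (n.+1%:R^-1 * x)) - expR (- t)) ^+ n *
      expR (- (n.+1%:R^-1 * x)))%:E) \_ `[0%R, (n.+1%:R * t)%R]) x))%E.
  apply: eq_integral => x _; rewrite patchE /K /max_exp_cdf.
  have n0 : 0 < n.+1%:R :> R by rewrite ltr0n.
  case: (boolP (x \in _)) => [|/negP xt].
    rewrite inE/= in_itv/= => /andP[x0 xt]; rewrite exponential_pdfE//.
    rewrite subr_ge0 ler_pdivrMl// xt -EFinM; congr EFin.
    (* with y = x / n.+1, the density [expR (- x)] supplies one factor
       [expR (- y)] to each of the [n] factors of the power, and one more *)
    set y := _^-1 * x.
    have -> : - 1 * x = n.+1%:R * - y.
      by rewrite mulN1r mulrN /y mulVKf// gt_eqF.
    rewrite expRM_natl exprSr opprB expRD mul1r mulrA -exprMn; congr (_ ^+ _ * _).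
    by rewrite mulrBl mul1r mulrAC -expRD subrr expR0 mul1r.
  case: (ltP x 0) => x0.
    by rewrite lt0_exponential_pdf// mule0.
  rewrite ifF ?mul0e//; apply/negP => xt'; apply: xt.
  by apply/mem_set; rewrite /= in_itv/= x0 -ler_pdivrMl// -subr_ge0.
rewrite -integral_mkcond.
case: (leP 0 t) => t0; first by rewrite integral_spacing_step// /max_exp_cdf t0.
rewrite /max_exp_cdf leNgt t0/= set_itv_ge ?integral_set0//.
by rewrite bnd_simp -ltNge pmulr_rlt0// ltr0n.
Qed.

(** * Sums and maxima of independent exponentials *)

(** Finite intersections of events with index 0 or greater than [m].  Index 0
    is always allowed because it carries the random number of terms, while the
    other indices are consumed one after the other. *)
Definition tail_event (T : Type) (F : nat -> set (set T)) (m : nat) (C : set T) :=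
  exists (J : {fset nat}) (A : nat -> set T),
    [/\ forall i, i \in J -> F i (A i),
        forall i, i \in J -> (i == 0)%N || (m < i)%N &
        C = \bigcap_(i in [set` J]) A i].

Section tail_event.
Context (R : realType) d (T : measurableType d) (P : probability T R).
Variable F : nat -> set (set T).
Hypothesis mF : forall i, F i `<=` measurable.
Hypothesis indepF : mutually_independent P F.

Lemma tail_eventT m : tail_event F m [set: T].
Proof.
exists fset0, (fun=> setT); split => //.
by rewrite set_fset0 bigcap_set0.
Qed.

Lemma tail_event_index m C : F 0%N C -> tail_event F m C.
Proof.
move=> FC; exists [fset 0%N]%fset, (fun=> C); split.
- by move=> i /fset1P ->.
- by move=> i /fset1P ->.
- by rewrite set_fset1 bigcap_set1.
Qed.

Lemma measurable_tail_event m C : tail_event F m C -> measurable C.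
Proof.
move=> [J [A [FA _ ->]]]; apply: fin_bigcap_measurable => // i /FA.
exact: mF.
Qed.

(** The event of index [m.+1] can be absorbed into the tail, and the product
    rule splits it off again. *)
Lemma tail_eventI m A C : F m.+1 A -> tail_event F m.+1 C ->
  tail_event F m (A `&` C) /\ (P (A `&` C) = P A * P C)%E.
Proof.
move=> FA [J [B [FB Jm ->]]].
have mJ : m.+1 \notin J by apply/negP => /Jm; rewrite ltnn.
pose B' i := if i == m.+1 then A else B i.
have B'J i : i \in J -> B' i = B i.
  by move=> iJ; rewrite /B'; case: eqP => // im; rewrite -im iJ in mJ.
have FB' i : i \in (m.+1 |` J)%fset -> F i (B' i).
  move=> /fset1UP[->|iJ]; first by rewrite /B' eqxx.
  by rewrite B'J//; exact: FB.
have AE : A `&` \bigcap_(i in [set` J]) B i =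
    \bigcap_(i in [set` (m.+1 |` J)%fset]) B' i.
  rewrite set_fsetU set_fset1 bigcap_setU bigcap_set1 /B' eqxx; congr (_ `&` _).
  by apply: eq_bigcapr => i iJ; rewrite -[RHS]/(B' i) B'J.
rewrite AE; split.
  exists (m.+1 |` J)%fset, B'; split => // i /fset1UP[->|/Jm /orP[->//|/ltnW ->]].
    by rewrite ltnSn orbT.
  by rewrite orbT.
rewrite indepF// big_fsetU1//= indepF//; congr (_ * _)%E.
  by rewrite /B' eqxx.
by apply: eq_big_seq => i iJ; rewrite B'J.
Qed.


Variable E : nat -> {RV P >-> R}.
Hypothesis FE : forall j, F j.+1 = g_sigma_algebra_preimage (E j.+1).
Hypothesis expE : forall j A, measurable A ->
  distribution P (E j.+1) A = exponential_prob 1 A.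

(** Renyi's representation of the maximum as the sum of the spacings. *)
Definition spacing_sum (m : nat) (w : T) : R :=
  \sum_(1 <= j < m.+1) j%:R^-1 * E j w.

Lemma measurable_spacing_sum m : measurable_fun [set: T] (spacing_sum m).
Proof.
rewrite /spacing_sum; apply: measurable_sum => j.
exact: measurable_funM.
Qed.

HB.instance Definition _ m :=
  isMeasurableFun.Build _ _ _ _ (spacing_sum m) (@measurable_spacing_sum m).

Lemma spacing_sumS m w :
  spacing_sum m.+1 w = m.+1%:R^-1 * E m.+1 w + spacing_sum m w.
Proof. by rewrite /spacing_sum big_nat_recr//= addrC. Qed.

(** The induction hypothesis of [spacing_sum_indep], named because it is also
    what the law of the next sum requires. *)
Let spacing_sum_indep_at m := forall C (B : set R),
  tail_event F m C -> measurable B ->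
  (P (spacing_sum m @^-1` B `&` C) = P (spacing_sum m @^-1` B) * P C)%E.

(** Independence from [C] and the convolution formula come at once: with
    [C = setT] this is the law of the sum, which for general [C] factors out. *)
Lemma spacing_sumS_law m C B : spacing_sum_indep_at m ->
  tail_event F m.+1 C -> measurable B ->
  (P (spacing_sum m.+1 @^-1` B `&` C) =
   (distribution P (E m.+1) \x distribution P (spacing_sum m))
     [set p | B (m.+1%:R^-1 * p.1 + p.2)%R] * P C)%E.
Proof.
move=> indep_m tC mB.
have mD : measurable [set p : R * R | B (m.+1%:R^-1 * p.1 + p.2)].
  have mf : measurable_fun [set: R * R] (fun p => m.+1%:R^-1 * p.1 + p.2).
    apply: measurable_funD => //; exact: measurable_funM.
  by rewrite -[X in measurable X]setTI; exact: mf.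
rewrite -(joint_law_of_rectangles (measurable_tail_event tC))//.
  by congr (P (_ `&` _)); apply/seteqP; split => w /=; rewrite spacing_sumS.
move=> A A' mA mA'.
have FA : F m.+1 (E m.+1 @^-1` A).
  by rewrite FE; exists A => //; rewrite setTI.
have [tAC PAC] := tail_eventI FA tC.
rewrite [_ @^-1` A `&` _]setIC -setIA indep_m// PAC muleA; congr (_ * _)%E.
by rewrite muleC.
Qed.

Lemma spacing_sum_indep m : spacing_sum_indep_at m.
Proof.
elim: m => [|m IH] C B tC mB.
  have -> : spacing_sum 0 = cst 0.
    by apply/funext => w; rewrite /spacing_sum big_geq.
  rewrite preimage_cst; case: ifPn => _.
    by rewrite setTI probability_setT mul1e.
  by rewrite set0I measure0 mul0e.
rewrite spacing_sumS_law// -[in RHS](setIT (_ @^-1` B)) spacing_sumS_law//.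
  by rewrite probability_setT mule1.
exact: tail_eventT.
Qed.

Lemma spacing_sum_cdf m t :
  P [set w | spacing_sum m w <= t] = (max_exp_cdf m t)%:E.
Proof.
have ray s n : [set w | spacing_sum n w <= s] =
    spacing_sum n @^-1` `]-oo, s]%classic.
  by apply/seteqP; split => w; rewrite /= in_itv.
elim: m t => [|m IH] t.
  rewrite (_ : mkset _ = if 0 <= t then setT else set0).
    rewrite /max_exp_cdf; case: ifPn => _; last exact: measure0.
    exact: probability_setT.
  apply/seteqP; rewrite /spacing_sum.
  by case: ifPn => t0; split => w //=; rewrite big_geq// (negbTE t0).
rewrite ray -[_ @^-1` _]setIT spacing_sumS_law//.
- rewrite probability_setT mule1.
  rewrite [X in (_ \x _)%E X](_ : _ = [set p | m.+1%:R^-1 * p.1 + p.2 <= t]).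
    by apply: spacing_step_cdf => [|s]; [exact: expE|rewrite -IH ray].
  by apply/seteqP; split => p; rewrite /= in_itv.
- exact: spacing_sum_indep.
- exact: tail_eventT.
Qed.

(** The events on E_1, ..., E_m are peeled off from the last one and moved into
    the tail. *)
Lemma exponential_bigcap_indep m C B : tail_event F m C -> measurable B ->
  (P (\bigcap_(j in [set j | (0 < j <= m)%N]) (E j @^-1` B) `&` C) =
   exponential_prob 1 B ^+ m * P C)%E.
Proof.
elim: m C => [|m IH] C tC mB.
  rewrite expe0 mul1e; congr (P _); rewrite -[RHS]setTI; congr (_ `&` _).
  by rewrite -subTset => w _ j /= /andP[j0]; rewrite leqNgt j0.
have FA : F m.+1 (E m.+1 @^-1` B).
  by rewrite FE; exists B => //; rewrite setTI.
have [tAC PAC] := tail_eventI FA tC.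
rewrite (_ : \bigcap_(j in _) _ = (\bigcap_(j in [set j | (0 < j <= m)%N])
   (E j @^-1` B)) `&` E m.+1 @^-1` B); last first.
  apply/seteqP; split => [w Ew|w [Ew1 Ew2] j /= /andP[j0]].
    split; last by apply: Ew; rewrite /= ltnSn.
    by move=> j /= /andP[j0 jm]; apply: Ew; rewrite /= j0 ltnW.
  by rewrite leq_eqVlt => /orP[/eqP ->//|jm]; apply: Ew1; rewrite /= j0.
rewrite -setIA IH// PAC muleA expeS; congr (_ * _)%E.
by rewrite muleC; congr (_ * _)%E; exact: expE.
Qed.

End tail_event.

Lemma exponential_prob_sq_le (R : realType) (t : R) : 0 <= t ->
  exponential_prob 1 [set x : R | x ^+ 2 <= t] =
    (max_exp_cdf 1 (Num.sqrt t))%:E.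
Proof.
move=> t0.
transitivity (exponential_prob 1 `[0, Num.sqrt t]%classic).
  (* the two sets differ by negative numbers only, where the density is 0 *)
  rewrite /exponential_prob integral_mkcond [RHS]integral_mkcond.
  apply: eq_integral => x _; rewrite !patchE.
  have [x0|x0] := ltP x 0.
    by rewrite lt0_exponential_pdf//; do 2 case: ifP.
  have xt : (x ^+ 2 <= t) = (x <= Num.sqrt t).
    by rewrite -[X in _ <= X]sqr_sqrtr// ler_sqr ?nnegrE ?sqrtr_ge0.
  by congr (if _ then _ else _); apply/idP/idP; rewrite !inE/= in_itv/= x0 xt.
rewrite /max_exp_cdf sqrtr_ge0 expr1.
have := sqrtr_ge0 t; rewrite le_eqVlt => /orP[/eqP <-|st0].
  by rewrite set_itv1 /exponential_prob integral_set1 oppr0 expR0 subrr.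
by rewrite exponential_prob_itv0c// mulN1r EFinB.
Qed.

Lemma max_exp_cdf01 (R : realType) (t : R) : 0 <= max_exp_cdf 1 t <= 1.
Proof.
rewrite /max_exp_cdf; case: ifPn => t0; last by rewrite lexx ler01.
have := expR_gt0 (- t); have : expR (- t) <= 1 by rewrite -expR0 ler_expR oppr_le0.
by rewrite expr1; lra.
Qed.

Lemma bigmax_nat_le (R : realType) (f : nat -> R) (n : nat) (t : R) : 0 <= t ->
  \big[Order.max/0]_(1 <= j < n.+1) f j <= t <->
  forall j, (0 < j <= n)%N -> f j <= t.
Proof.
move=> t0; split=> [ft j jn|ft].
  by apply: le_trans ft; apply: le_bigmax_seq => //; rewrite mem_index_iota.
by rewrite big_nat; apply: bigmax_le.
Qed.

(** * Random number of terms *)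

(** Only countably many values of the index occur: split along them. *)
Lemma measurable_random_index (R : realType) d (T : measurableType d)
    (N : T -> nat) (Y : nat -> T -> R) :
  measurable_fun [set: T] N -> (forall n, measurable_fun [set: T] (Y n)) ->
  measurable_fun [set: T] (fun w => Y (N w) w).
Proof.
move=> mN mY _ B mB; rewrite setTI.
rewrite (_ : _ @^-1` _ = \bigcup_n (N @^-1` [set n] `&` Y n @^-1` B)).
  apply: bigcup_measurable => n _; apply: measurableI.
    by rewrite -[X in measurable X]setTI; exact: mN.
  by rewrite -[X in measurable X]setTI; exact: mY.
apply/seteqP; split => [w Yw|w [n _ []] /=]; first by exists (N w).
by move=> <-.
Qed.

Lemma probability_random_index (R : realType) d (T : measurableType d)
    (P : probability T R) (N : T -> nat) (Y : nat -> T -> R) (B : set R) :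
  measurable_fun [set: T] N -> (forall n, measurable_fun [set: T] (Y n)) ->
  measurable B ->
  P [set w | B (Y (N w) w)] =
  (\sum_(0 <= n <oo) P ([set w | N w = n] `&` Y n @^-1` B))%E.
Proof.
move=> mN mY mB.
rewrite -measure_semi_bigcup; first congr (P _).
- apply/seteqP; split => [w Yw|w [n _ []] /=]; first by exists (N w).
  by move=> <-.
- move=> n; apply: measurableI.
    by rewrite -[X in measurable X]setTI; exact: (mN _ [set n]).
  by rewrite -[X in measurable X]setTI; exact: mY.
- by move=> i j _ _ [w [[/= <- _] [<-]]].
- apply: bigcup_measurable => n _; apply: measurableI.
    by rewrite -[X in measurable X]setTI; exact: (mN _ [set n]).
  by rewrite -[X in measurable X]setTI; exact: mY.
Qed.

(** The generating function of the law of N: it sums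
    [(theta (1 - theta)^n + (1 - theta) theta^n) u^n] over [n >= 1]. *)
Definition geometric_mixture_gf (R : realType) (theta u : R) : R :=
  theta * (1 - theta) * u / (1 - (1 - theta) * u) +
  theta * (1 - theta) * u / (1 - theta * u).

Lemma geometric_mixture_series (R : realType) (theta u : R) :
  0 < theta < 1 -> 0 <= u <= 1 ->
  (\sum_(0 <= n <oo) ((theta * (1 - theta) ^+ n.+1 +
     (1 - theta) * theta ^+ n.+1) * u ^+ n.+1)%:E)%E =
  (geometric_mixture_gf theta u)%:E.
Proof.
move=> /andP[th0 th1] /andP[u0 u1]; apply/cvg_lim => //.
have small x : 0 <= x < 1 -> `|x * u| < 1.
  by move=> /andP[x0 x1]; rewrite ger0_norm ?mulr_ge0//; nra.
rewrite (_ : (fun n => _) = EFin \o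
  (series (geometric (theta * (1 - theta) * u) ((1 - theta) * u)) \+
   series (geometric (theta * (1 - theta) * u) (theta * u)))); last first.
  apply/funext => n; rewrite /= /series/= sumEFin -big_split/=; congr EFin.
  by apply: eq_bigr => i _; rewrite !exprMn !exprS; ring.
apply: cvg_EFin; first by near=> n.
apply: (@cvgD _ R^o); apply: cvg_geometric_series; apply: small; lra.
Unshelve. all: by end_near.
Qed.

Section random_index.
Context (R : realType) d (T : measurableType d) (P : probability T R).
Variables (theta : R) (N : T -> nat).
Hypothesis theta01 : 0 < theta < 1.
Hypothesis mN : measurable_fun [set: T] N.
Hypothesis lawN : forall n : nat, (1 <= n)%N ->
  P [set w | N w = n] =
    (theta * (1 - theta) ^+ n + (1 - theta) * theta ^+ n)%:E.

Let measurable_index n : measurable [set w | N w = n].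
Proof.
by rewrite -[X in measurable X]setTI -[mkset _]/(N @^-1` [set n]); exact: mN.
Qed.

Lemma random_index_gf (Y : nat -> T -> R) (B : set R) (u : R) :
  (forall n, measurable_fun [set: T] (Y n)) -> measurable B -> 0 <= u <= 1 ->
  (forall n, (1 <= n)%N ->
    P ([set w | N w = n] `&` Y n @^-1` B) =
      (P [set w | N w = n] * (u ^+ n)%:E)%E) ->
  P [set w | B (Y (N w) w)] =
    (P ([set w | N w = 0%N] `&` Y 0%N @^-1` B) +
     (geometric_mixture_gf theta u)%:E)%E.
Proof.
move=> mY mB u01 YE.
have mYB n : measurable (Y n @^-1` B).
  by rewrite -[X in measurable X]setTI; exact: mY.
rewrite (probability_random_index P mN mY mB) nneseries_recl//; congr (_ + _)%E.
rewrite -(nneseries_addn 1)// -geometric_mixture_series//.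
by apply: eq_eseriesr => n _; rewrite addn1 YE// lawN// -EFinM.
Qed.

(** The prescribed masses of the positive integers already add up to the value 1
    of the generating function at 1. *)
Lemma random_index_eq0 : P [set w | N w = 0%N] = 0%E.
Proof.
have /andP[th0 th1] := theta01.
have : P [set: T] = (P ([set w | N w = 0%N] `&` (cst 0%R : T -> R) @^-1` [set: R]) +
    (geometric_mixture_gf theta 1)%:E)%E.
  apply: (@random_index_gf (fun=> cst 0%R) setT 1) => //.
  - by rewrite ler01 lexx.
  - by move=> n _; rewrite preimage_setT setIT expr1n mule1.
have -> : geometric_mixture_gf theta 1 = 1.
  by rewrite /geometric_mixture_gf; field; apply/andP; split; lra.
rewrite preimage_setT setIT probability_setT.
rewrite -(fineK (fin_num_measure P _ (measurable_index 0))) -EFinD => -[e].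
by congr EFin; lra.
Qed.

Lemma random_index_mixture (Y : nat -> T -> R) (B : set R) (u : R) :
  (forall n, measurable_fun [set: T] (Y n)) -> measurable B -> 0 <= u <= 1 ->
  (forall n, (1 <= n)%N ->
    P ([set w | N w = n] `&` Y n @^-1` B) =
      (P [set w | N w = n] * (u ^+ n)%:E)%E) ->
  P [set w | B (Y (N w) w)] = (geometric_mixture_gf theta u)%:E.
Proof.
move=> mY mB u01 YE; rewrite (random_index_gf mY mB u01 YE) -[RHS]add0e; congr (_ + _)%E.
have mY0 : measurable (Y 0%N @^-1` B).
  by rewrite -[X in measurable X]setTI; exact: mY.
apply/eqP; rewrite -measure_le0 -random_index_eq0.
apply: le_measure; rewrite ?inE//.
exact: measurableI.
Qed.

End random_index.

(** * The shifted logistic variable *)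

Lemma logistic_cdf_bounds (R : realType) (x : R) : 0 < logistic_cdf x < 1.
Proof.
have ex : 0 < expR (- x) := expR_gt0 _.
rewrite /logistic_cdf invr_gt0 invf_lt1; last lra.
by apply/andP; split; lra.
Qed.

(** An explicit form of left continuity, which excludes atoms; it comes from
    [F (a - e) >= expR (- e) * F a >= (1 - e) * F a] and [F a <= 1]. *)
Lemma logistic_cdf_subr_le (R : realType) (a e : R) : 0 <= e ->
  logistic_cdf a - e <= logistic_cdf (a - e).
Proof.
move=> e0; have /andP[F0 F1] := logistic_cdf_bounds a.
apply: (@le_trans _ _ (expR (- e) * logistic_cdf a)).
  have := expR_ge1Dx (- e) => h.
  apply: (@le_trans _ _ ((1 - e) * logistic_cdf a)); first nra.
  by rewrite ler_wpM2r// ltW.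
rewrite expRN -invfM lef_pV2.
- rewrite mulrDr mulr1 lerD ?expR_ge1Dx//; last by rewrite -expRD opprB.
  have := expR_ge1Dx e; lra.
- by rewrite posrE ?mulr_gt0 ?addr_gt0 ?expR_gt0.
- by rewrite posrE ?mulr_gt0 ?addr_gt0 ?expR_gt0.
Qed.

(** An identity between rational functions of [expR (- t)] and [expR delta]. *)
Lemma logistic_interval (R : realType) (delta t : R) :
  logistic_cdf (t - delta) - logistic_cdf (- t - delta) =
  geometric_mixture_gf (logistic_cdf delta) (1 - expR (- t)).
Proof.
rewrite /geometric_mixture_gf (logistic_cdfE delta) /logistic_cdf.
have -> : - (t - delta) = - t + delta by ring.
have -> : - (- t - delta) = t + delta by ring.
have := expR_gt0 delta; have := expR_gt0 (- t).
have -> : expR (t + delta) = (expR (- t))^-1 * expR delta.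
  by rewrite expRD expRN invrK.
rewrite expRD.
move: (expR (- t)) (expR delta) => s d s0 d0.
have d1 : 1 + d != 0 by rewrite gt_eqF// addr_gt0.
have -> : 1 - d / (1 + d) = (1 + d)^-1 by field.
have -> : 1 - (1 + d)^-1 * (1 - s) = (d + s) / (1 + d) by field.
have -> : 1 - d / (1 + d) * (1 - s) = (1 + d * s) / (1 + d) by field.
by field; do ?[apply/andP; split]; rewrite gt_eqF//; nra.
Qed.

Section abs_logistic.
Context (R : realType) d (T : measurableType d) (P : probability T R).
Variables (X : {RV P >-> R}).
Hypothesis hX : forall x : R, cdf X x = (logistic_cdf x)%:E.

Let mX (i : interval R) : measurable (X @^-1` [set` i]).
Proof. exact: measurable_funPTI. Qed.

(** Needed because the interval cut out by [`|X + delta| <= t] contains its left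
    end point: an atom there would be missed by a difference of values of F. *)
Lemma logistic_lt (a : R) : P (X @^-1` `]-oo, a[) = (logistic_cdf a)%:E.
Proof.
have Pfin : P (X @^-1` `]-oo, a[) \is a fin_num by apply: fin_num_measure.
apply/eqP; rewrite eq_le; apply/andP; split.
  rewrite -hX; apply: le_measure; rewrite ?inE//.
  by move=> w; rewrite /= !in_itv/=; exact: ltW.
rewrite -(fineK Pfin) lee_fin; apply/ler_addgt0Pr => e e0.
rewrite -lerBlDr (le_trans (logistic_cdf_subr_le _ (ltW e0)))//.
rewrite -lee_fin fineK// -hX; apply: le_measure; rewrite ?inE//.
move=> w; rewrite /= !in_itv/= => /le_lt_trans; apply.
by rewrite gtrBl.
Qed.

Lemma abs_logistic_cdf (delta t : R) :
  P [set w | `|X w + delta| <= t] =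
  (geometric_mixture_gf (logistic_cdf delta) (max_exp_cdf 1 t))%:E.
Proof.
rewrite /max_exp_cdf; case: ifPn => t0; last first.
  rewrite /geometric_mixture_gf !mulr0 !mul0r addr0.
  rewrite (_ : mkset _ = set0) ?measure0//; apply/seteqP; split => w //=.
  by move=> Xt; apply: (negP t0); exact: le_trans Xt.
rewrite expr1 -logistic_interval EFinB -hX -logistic_lt.
have low_sub : X @^-1` `]-oo, - t - delta[ `<=` X @^-1` `]-oo, t - delta].
  by move=> w; rewrite /= !in_itv/=; lra.
rewrite -[X in (_ - P X)%E](setIidr low_sub) -measureD//.
  congr (P _); apply/seteqP; split => w; rewrite /= !in_itv/= ler_norml.
    by move=> /andP[? ?]; split; [lra|apply/negP; rewrite -leNgt; lra].
  by move=> [? /negP]; rewrite -leNgt => ?; apply/andP; split; lra.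
by rewrite (le_lt_trans (probability_le1 _ _)) ?ltry.
Qed.

End abs_logistic.

(** * The two representations *)

Theorem theorem1 (R : realType)
  (d : measure_display) (T : measurableType d) (P : probability T R)
  (X : {RV P >-> R})
  (hX : forall x : R, cdf X x = (logistic_cdf x)%:E)
  (delta : R) (hdelta : delta != 0)
  (theta : R) (htheta : theta = logistic_cdf delta)
  (d' : measure_display) (T' : measurableType d') (P' : probability T' R)
  (N : {RV P' >-> nat}) (E : nat -> {RV P' >-> R})
  (hindep : mutually_independent P' (sigma_count_family N (fun j => E j)))
  (hE : forall j : nat, (1 <= j)%N -> forall B : set R, measurable B ->
     distribution P' (E j) B = exponential_prob 1 B)
  (hN : forall n : nat, (1 <= n)%N ->
     P' [set w | N w = n] =
       (theta * (1 - theta) ^+ n + (1 - theta) * theta ^+ n)%:E) :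
  eq_in_distribution P P'
    (fun w => `|X w + delta|)
    (fun w => \sum_(1 <= j < (N w).+1) j%:R^-1 * E j w)
  /\
  (* the squares are nonnegative, so the starting value 0 of the iterated
     maximum does not affect it as soon as N w >= 1 *)
  eq_in_distribution P P'
    (fun w => (X w + delta) ^+ 2)
    (fun w => \big[Order.max/0]_(1 <= j < (N w).+1) (E j w) ^+ 2).
Proof.
have theta01 : 0 < theta < 1 by rewrite htheta logistic_cdf_bounds.
have mN : measurable_fun [set: T'] N by [].
set F := sigma_count_family N (fun j => E j) in hindep.
have mF i : F i `<=` measurable.
  case: i => [|i] _ [B mB <-]; rewrite setTI.
    exact: measurable_funPTI.
  exact: measurable_funPTI.
have FN n : F 0%N [set w | N w = n].
  by exists [set n] => //; rewrite setTI.
have FE j : F j.+1 = g_sigma_algebra_preimage (E j.+1) by [].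
have expE j A : measurable A ->
    distribution P' (E j.+1) A = exponential_prob 1 A.
  by move=> mA; exact: hE.
pose M n w := \big[Order.max/0]_(1 <= j < n.+1) E j w ^+ 2.
have mM n : measurable_fun [set: T'] (M n).
  rewrite /M; elim: (index_iota _ _) => [|j s IH].
    under eq_fun do rewrite big_nil.
    exact: measurable_cst.
  under eq_fun do rewrite big_cons.
  by apply: measurable_maxr => //; exact: measurable_funX.
split; apply: eq_in_distribution_cdf.
- by apply: measurableT_comp => //; exact: measurable_funD.
- exact: (measurable_random_index mN (measurable_spacing_sum E)).
- move=> t; rewrite abs_logistic_cdf// -htheta; apply/esym.
  apply: (random_index_mixture theta01 mN hN (measurable_spacing_sum E)
    (B := [set x | x <= t])) => [||n n1].
  + by rewrite -set_itvNyc; exact: measurable_itv.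
  + exact: max_exp_cdf01.
  + rewrite setIC.
    have := spacing_sum_indep mF hindep FE (tail_event_index n (FN n)).
    move=> ->; last by rewrite -set_itvNyc; exact: measurable_itv.
    rewrite muleC; congr (_ * _)%E.
    rewrite -[LHS]/(P' [set w | spacing_sum E n w <= t]).
    rewrite (spacing_sum_cdf mF hindep FE expE) /max_exp_cdf.
    by case: ifP; rewrite ?expr1// expr0n eqn0Ngt n1.
- by apply: measurable_funX; exact: measurable_funD.
- exact: (measurable_random_index mN mM).
- move=> t; have [t0|t0] := leP 0 t; last first.
    have nneg_gt (x : R) : 0 <= x -> ~ x <= t.
      by move=> x0 xt; have := lt_le_trans t0 (le_trans x0 xt); rewrite ltxx.
    rewrite [X in P X = _](_ : _ = set0) ?[X in _ = P' X](_ : _ = set0).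
    - by rewrite !measure0.
    - by apply/seteqP; split => w //= /nneg_gt; apply; exact: bigmax_ge_id.
    - by apply/seteqP; split => w //= /nneg_gt; apply; exact: sqr_ge0.
  transitivity (P [set w | `|X w + delta| <= Num.sqrt t]).
    congr (P _); apply/seteqP; split => w /=;
    by rewrite -[_ <= Num.sqrt t]ler_sqr ?nnegrE ?sqrtr_ge0// sqr_sqrtr// real_normK// num_real.
  rewrite abs_logistic_cdf// -htheta; apply/esym.
  apply: (random_index_mixture theta01 mN hN mM (B := [set x | x <= t])) => [||n n1].
  + by rewrite -set_itvNyc; exact: measurable_itv.
  + exact: max_exp_cdf01.
  + rewrite (_ : _ @^-1` _ = \bigcap_(j in [set j | (0 < j <= n)%N])
        (E j @^-1` [set x | x ^+ 2 <= t])); last first.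
      by apply/seteqP; split => w /=; move/(bigmax_nat_le (fun j => E j w ^+ 2) n t0).
    rewrite setIC (exponential_bigcap_indep hindep FE expE (tail_event_index n (FN n))).
      by rewrite exponential_prob_sq_le// -EFin_expe muleC.
    rewrite -[X in measurable X]setTI.
    have mf : measurable_fun [set: R] (fun x : R => x ^+ 2) by [].
    rewrite -[X in _ `&` X]/((fun x : R => x ^+ 2) @^-1` [set x | x <= t]).
    by apply: mf => //; rewrite -set_itvNyc; exact: measurable_itv.
Qed.
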